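(* Let $(V,m,b)$ be an infinite weighted directed graph satisfying the standing assumptions (locally finite, weakly connected, $\sum_{y}b(x,y)>0$ for all $x$, and Kirchhoff's assumption), and let $b'(x,y)=\frac{b(x,y)+b(y,x)}{2}$. If $$\exists C>0,\ \forall x\in V,\quad \frac{1}{m(x)}\sum_{y\in V_x}\frac{|b(x,y)-b(y,x)|^2}{b'(x,y)}\leq C ,$$ then the Laplacian $\Delta$ (with domain $\mathcal C_c(V)$) is sectorial.
   Context: Graph: $V$ is a countable set, $b:V\times V\to[0,\infty)$ satisfies $b(x,x)=0$ for all $x$, and $m:V\to(0,\infty)$ is a weight on vertices. For $x\in V$, $V_x=\{y\in V: b(x,y)>0\text{ or }b(y,x)>0\}$. Standing assumptions: (1) locally finite: every $V_x$ is finite; (2) weakly connected: any two vertices are joined by a finite chain of undirected edges $\{x,y\}$ (pairs with $b(x,y)>0$ or $b(y,x)>0$); (3) $\sum_{y\in V}b(x,y)>0$ for all $x\in V$; (4) Kirchhoff's assumption: $\sum_{y}b(x,y)=\sum_{y}b(y,x)$ for all $x\in V$. Function spaces: $\mathcal C_c(V)$ is the set of finitely supported functions $V\to\mathbb C$; $\ell^2(V,m)$ is the Hilbert space of $f:V\to\mathbb C$ with $\sum_x m(x)|f(x)|^2<\infty$, with scalar product $\langle f,g\rangle=\sum_x m(x)f(x)\overline{g(x)}$. Laplacian: $\Delta$ is the operator on $\ell^2(V,m)$ with domain $\mathcal C_c(V)$, $\Delta f(x)=\frac{1}{m(x)}\sum_{y\in V}b(x,y)(f(x)-f(y))$. The numerical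 range of an operator $A$ with domain $D(A)$ is $W(A)=\{\langle Af,f\rangle: f\in D(A),\ \|f\|=1\}$. $A$ is sectorial if there exist $a\in\mathbb R$ (the vertex) and $\theta\in[0,\pi/2)$ (the semi-angle) such that $W(A)\subset S_{a,\theta}:=\{z\in\mathbb C: |\operatorname{Im} z|\le \tan\theta\,(\operatorname{Re} z-a)\text{ and }\operatorname{Re}z\ge a\}$, i.e. $|\arg(z-a)|\le\theta$ (with $z=a$ included). *)

(* Defs.v *)
From mathcomp Require Import all_boot all_order all_algebra.
From mathcomp Require Import complex.
From mathcomp Require Import all_classical all_reals all_analysis.
From mathcomp Require summability.
Set Implicit Arguments.
Unset Strict Implicit.
Unset Printing Implicit Defensive.
Import Order.TTheory GRing.Theory Num.Theory numFieldNormedType.Exports.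
Local Open Scope classical_set_scope.
Local Open Scope ring_scope.
Local Open Scope complex_scope.

Record wdigraph (R : realType) (V : countType) := Wdigraph {
  wt : V -> V -> R;
  vm : V -> R;
  wt_ge0 : forall x y, 0 <= wt x y;
  wt_diag : forall x, wt x x = 0;
  vm_gt0 : forall x, 0 < vm x }.

Section Graph.
Variables (R : realType) (V : countType) (G : wdigraph R V).
Local Notation b := (wt G).

Definition adj (x y : V) : bool := (0 < b x y) || (0 < b y x).

Definition nbhd (x : V) : set V := [set y | adj x y].

Definition locally_finite : Prop := forall x, finite_set (nbhd x).

Definition weakly_connected : Prop :=
  forall x y, exists p : seq V, path adj x p /\ last x p = y.

(* [\sum_(y \in A)] is the finite-support sum of fsbigop: it is the full sum
   only when the summand has finite support in [A].  For all the sums over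
   [[set: V]] below this is ensured by local finiteness. *)
Definition outgoing (x : V) : R := \sum_(y \in [set: V]) b x y.

Definition ingoing (x : V) : R := \sum_(y \in [set: V]) b y x.

Definition kirchhoff : Prop := forall x, outgoing x = ingoing x.

Definition symmetrized (x y : V) : R := (b x y + b y x) / 2.

Definition laplacian_fun (f : V -> R[i]) (x : V) : R[i] :=
  ((vm G x)^-1)%:C * \sum_(y \in [set: V]) (b x y)%:C * (f x - f y).

End Graph.

Section L2.
Variables (R : realType) (V : countType) (m : V -> R).

Definition finitely_supported : set (V -> R[i]) :=
  [set f | finite_set [set x | f x != 0]].

Definition l2 : set (V -> R[i]) :=
  [set f | (\esum_(x in [set: V])
              (m x * ComplexField.Normc.normc (f x) ^+ 2)%:E < +oo)%E].

(* Unconditional sum: the limit of the finite partial sums along the filter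
   of all large enough finite subsets of [V]. *)
Definition l2_dot (f g : V -> R[i]) : R[i] :=
  summability.sum (fun x => (m x)%:C * f x * conjc (g x) : R[i]^o).

Definition l2_norm (f : V -> R[i]) : R := Num.sqrt (complex.Re (l2_dot f f)).

(* A linear, possibly unbounded operator in l^2(V, m); the values of [opfun]
   outside [opdom] are irrelevant. *)
Record operator := Operator {
  opdom : set (V -> R[i]);
  opfun : (V -> R[i]) -> V -> R[i];
  opdom0 : opdom (fun=> 0);
  opdomP : forall (a : R[i]) (f g : V -> R[i]), opdom f -> opdom g ->
    opdom (fun x => a * f x + g x);
  opfun_linear : forall (a : R[i]) (f g : V -> R[i]), opdom f -> opdom g ->
    opfun (fun x => a * f x + g x) = (fun x => a * opfun f x + opfun g x);
  opdom_l2 : opdom `<=` l2;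
  opfun_l2 : forall f, opdom f -> l2 (opfun f) }.

Definition numerical_range (A : operator) : set R[i] :=
  [set l2_dot (opfun A f) f | f in [set f | opdom A f /\ l2_norm f = 1]].

Definition sector (a theta : R) : set R[i] :=
  [set z | `|complex.Im z| <= tan theta * (complex.Re z - a) /\ a <= complex.Re z].

Definition sectorial (A : operator) : Prop :=
  exists a theta : R,
    [/\ 0 <= theta, theta < pi / 2 & numerical_range A `<=` sector a theta].

Lemma finitely_supported0 : finitely_supported (fun=> 0).
Proof.
apply: (@sub_finite_set _ _ set0); last exact: finite_set0.
by move=> x /=; rewrite eqxx.
Qed.

Lemma finitely_supportedP (a : R[i]) (f g : V -> R[i]) :
  finitely_supported f -> finitely_supported g ->
  finitely_supported (fun x => a * f x + g x).
Proof.
move=> ff fg.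
apply: (@sub_finite_set _ _ ([set x | f x != 0] `|` [set x | g x != 0])).
  move=> x /=; case: (eqVneq (f x) 0) => [->|]; last by left.
  by rewrite mulr0 add0r; right.
by rewrite finite_setU.
Qed.

Lemma finitely_supported_l2 : finitely_supported `<=` l2.
Proof.
move=> f ff; rewrite /l2 /=.
pose s : V -> R := fun x => `|m x| * ComplexField.Normc.normc (f x) ^+ 2.
apply: (@le_lt_trans _ _ (\esum_(x in [set: V]) (s x)%:E)%E).
  apply: le_esum => x _; rewrite lee_fin ler_wpM2r ?exprn_ge0//.
    by case: (f x) => u v /=; exact: sqrtr_ge0.
  exact: ler_norm.
have s0 x : 0 <= s x by rewrite mulr_ge0 ?sqr_ge0.
rewrite (esumID [set x | f x != 0])//= ?setTI; last first.
  by move=> x _; rewrite lee_fin.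
rewrite [X in (_ + X)%E]esum1 ?adde0; last first.
  move=> x /= /negP; rewrite negbK => /eqP fx0.
  by rewrite /s fx0 /= expr0n addr0 sqrtr0 expr0n mulr0.
rewrite esum_fset//; last by move=> x _; rewrite lee_fin.
by rewrite fsumEFin// ltry.
Qed.

End L2.

Section Laplacian.
Variables (R : realType) (V : countType) (G : wdigraph R V).
Hypothesis lfG : locally_finite G.

Let laplacian_nbhd f x : laplacian_fun G f x =
  ((vm G x)^-1)%:C * \sum_(y \in nbhd G x) (wt G x y)%:C * (f x - f y).
Proof.
rewrite /laplacian_fun; congr (_ * _); apply/esym/fsbig_widen => // y [_ /negP].
rewrite /adj negb_or => /andP[/negP bxy _] /=.
have -> : wt G x y = 0.
  by apply/eqP; rewrite eq_le wt_ge0 andbT leNgt; apply/negP.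
by rewrite mul0r.
Qed.

Lemma laplacian_fun_linear (a : R[i]) (f g : V -> R[i]) :
  laplacian_fun G (fun x => a * f x + g x) =
  (fun x => a * laplacian_fun G f x + laplacian_fun G g x).
Proof.
apply/funext => x; rewrite !laplacian_nbhd mulrCA -mulrDr; congr (_ * _).
rewrite !fsbig_finite//= mulr_sumr -big_split/=.
by apply: eq_bigr => y _; rewrite opprD addrACA -mulrBr mulrDr mulrCA.
Qed.

Lemma laplacian_fun_finitely_supported f :
  finitely_supported f -> finitely_supported (laplacian_fun G f).
Proof.
move=> ff; pose S := [set x | f x != 0].
apply: (@sub_finite_set _ _ (S `|` \bigcup_(y in S) nbhd G y)); last first.
  by rewrite finite_setU; split=> //; apply: bigcup_finite.
move=> x /= Lx; apply: contrapT => /not_orP[/negP]; rewrite negbK => /eqP fx0.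
move=> nx; case/negP: Lx; apply/eqP; rewrite laplacian_nbhd fsbig1 ?mulr0//.
move=> y xy; suff -> : f y = 0 by rewrite fx0 subrr mulr0.
apply/eqP/negPn/negP => fy; apply: nx; exists y => //.
by move: xy; rewrite /nbhd /= /adj orbC.
Qed.

Definition laplacian : operator (vm G) :=
  Operator (@finitely_supported0 R V) (@finitely_supportedP R V)
    (fun a f g _ _ => laplacian_fun_linear a f g)
    (@finitely_supported_l2 R V (vm G))
    (fun f ff =>
       finitely_supported_l2 (vm G) (laplacian_fun_finitely_supported ff)).

End Laplacian.

(* Main.v *)
Require Import Defs.
From mathcomp Require Import all_boot all_order all_algebra.
From mathcomp Require Import complex.
From mathcomp Require Import all_classical all_reals all_analysis.
From mathcomp Require Import finmap ring lra.
From mathcomp Require summability.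
Import Order.TTheory GRing.Theory Num.Theory numFieldNormedType.Exports.
Local Open Scope classical_set_scope.
Local Open Scope ring_scope.

(** The idea is that the numerical range only sees finite sums, on which the
real part of the form is controlled by the symmetric part of the weight and
the imaginary part by its antisymmetric part.

For [f] finitely supported, let [T] be a finite set of vertices containing the
support of [f] and all its neighbours; then
[q = <Delta f, f> = \sum_(x, y in T) b(x,y) (f(x) - f(y)) conj(f(x))].
- Since [2 Re ((z - w) conj z) = |z - w|^2 + |z|^2 - |w|^2], and since
  Kirchhoff's assumption makes the telescoping part
  [\sum b(x,y) (|f(x)|^2 - |f(y)|^2)] vanish, [2 Re q] is the Dirichlet energy
  [\sum b(x,y) |f(x) - f(y)|^2] ([Re_directed_form]), in which [b] may be
  replaced by its symmetrization [b'].
- Since [Im ((z - w) conj z)] is antisymmetric in [z], [w], only the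
  antisymmetric part of [b] contributes to [Im q]:
  [2 Im q = \sum (b(x,y) - b(y,x)) Im ((f(x) - f(y)) conj(f(x)))]
  ([Im_directed_form]).

Young's inequality, weighted by [b'], bounds each term of the last sum by
[(b' |f(x) - f(y)|^2 + (b(x,y) - b(y,x))^2 / b' |f(x)|^2) / 2]
([skew_young]).  Summing, the first part gives half the energy, and the
hypothesis bounds the second part by [C/2 * ||f||^2].  Hence
[|Im q| <= (Re q + C/2) / 2] when [||f|| = 1]: the operator is sectorial with
vertex [- C/2] and semi-angle [atan (1/2)]. *)

(** * Complex finite sums *)

Definition sqnorm {R : realType} (z : R[i]) : R :=
  complex.Re z ^+ 2 + complex.Im z ^+ 2.

Section ComplexSums.
Variable R : realType.
Implicit Types (z w : R[i]) (b d : R).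

Lemma sqnorm_ge0 z : 0 <= sqnorm z.
Proof. by rewrite addr_ge0 ?sqr_ge0. Qed.

Lemma Re_sum (I : Type) (r : seq I) (F : I -> R[i]) :
  complex.Re (\sum_(i <- r) F i) = \sum_(i <- r) complex.Re (F i).
Proof. by apply: (big_morph (@complex.Re R)) => // -[? ?] [? ?]. Qed.

Lemma Im_sum (I : Type) (r : seq I) (F : I -> R[i]) :
  complex.Im (\sum_(i <- r) F i) = \sum_(i <- r) complex.Im (F i).
Proof. by apply: (big_morph (@complex.Im R)) => // -[? ?] [? ?]. Qed.

Lemma Re_edge b z w :
  complex.Re (b%:C%C * (z - w) * conjc z) =
  b * (sqnorm (z - w) + sqnorm z - sqnorm w) / 2.
Proof. by case: z w => [u v] [u' v'] /=; rewrite /sqnorm /=; field. Qed.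

Lemma Im_edge b z w :
  complex.Im (b%:C%C * (z - w) * conjc z) = b * complex.Im ((z - w) * conjc z).
Proof. by case: z w => [u v] [u' v'] /=; ring. Qed.

Lemma Im_edge_antisym z w :
  complex.Im ((z - w) * conjc z) = - complex.Im ((w - z) * conjc w).
Proof. by case: z w => [u v] [u' v'] /=; ring. Qed.

Lemma sqnormB_sym z w : sqnorm (z - w) = sqnorm (w - z).
Proof. by case: z w => [u v] [u' v'] /=; rewrite /sqnorm /=; ring. Qed.

(** Young's inequality with weight [s].  The case [s = 0] corresponds to pairs
of vertices that are not joined by an edge. *)
Lemma skew_young s d z w : 0 <= s -> (s = 0 -> d = 0) ->
  `|d * complex.Im ((z - w) * conjc z)| <=
  (s * sqnorm (z - w) + d ^+ 2 / s * sqnorm z) / 2.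
Proof.
rewrite le_eqVlt => /predU1P[<- /(_ erefl) ->|s0 _].
  by rewrite !mul0r normr0 expr0n /= !mul0r addr0 mul0r.
(* Completing the square: [s] times the difference of the two sides is
   [|s (z - w) - i d z|^2 / 2] or [|s (z - w) + i d z|^2 / 2], according to the
   sign of the left-hand side. *)
have -> : s * sqnorm (z - w) + d ^+ 2 / s * sqnorm z =
    s^-1 * (s ^+ 2 * sqnorm (z - w) + d ^+ 2 * sqnorm z).
  by field; rewrite gt_eqF.
rewrite -mulrA ler_pdivlMl// -[in X in X <= _](ger0_norm (ltW s0)) -normrM.
rewrite ler_norml; case: z w => [u v] [u' v']; rewrite /sqnorm /=.
set p := u - u'; set q := v - v'.
have := sqr_ge0 (s * p + d * v); have := sqr_ge0 (s * q - d * u).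
have := sqr_ge0 (s * p - d * v); have := sqr_ge0 (s * q + d * u).
by move=> *; apply/andP; split; lra.
Qed.

End ComplexSums.

(** * The form of a directed weight on finitely many vertices *)

Section DirectedForm.
Variables (R : realType) (V : eqType) (b : V -> V -> R) (T : seq V).
Variable f : V -> R[i].

Definition directed_form : R[i] :=
  \sum_(x <- T) \sum_(y <- T) (b x y)%:C%C * (f x - f y) * conjc (f x).

Definition energy (s : V -> V -> R) : R :=
  \sum_(x <- T) \sum_(y <- T) s x y * sqnorm (f x - f y).

(** The balance is only asked on the support of [f], because at the other
vertices of [T] some edges leave [T]. *)
Lemma Re_directed_form :
  (forall x, x \in T -> f x != 0 ->
    \sum_(y <- T) b x y = \sum_(y <- T) b y x) ->
  complex.Re directed_form = energy b / 2.
Proof.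
move=> balanced.
have tele : \sum_(x <- T) \sum_(y <- T) b x y * sqnorm (f x) =
            \sum_(x <- T) \sum_(y <- T) b x y * sqnorm (f y).
  rewrite [RHS]exchange_big /=; apply: eq_big_seq => x xT.
  rewrite -!mulr_suml; have [->|fx0] := eqVneq (f x) 0.
    by rewrite /sqnorm /= expr0n addr0 !mulr0.
  by rewrite balanced.
rewrite /energy mulr_suml Re_sum.
under eq_bigr => x _.
  rewrite Re_sum; under eq_bigr => y _ do rewrite Re_edge mulrBr mulrDr.
  rewrite -mulr_suml big_split /= big_split /= sumrN; over.
rewrite -!mulr_suml big_split /= big_split /= sumrN tele; congr (_ / _).
by rewrite -addrA subrr addr0.
Qed.

Lemma Im_directed_form :
  complex.Im directed_form =
  (\sum_(x <- T) \sum_(y <- T)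
     (b x y - b y x) * complex.Im ((f x - f y) * conjc (f x))) / 2.
Proof.
have -> : complex.Im directed_form = \sum_(x <- T) \sum_(y <- T)
    b x y * complex.Im ((f x - f y) * conjc (f x)).
  rewrite Im_sum; apply: eq_bigr => x _; rewrite Im_sum.
  by apply: eq_bigr => y _; rewrite Im_edge.
set q := (X in X = _ / _).
have swap : \sum_(x <- T) \sum_(y <- T)
    b y x * complex.Im ((f x - f y) * conjc (f x)) = - q.
  rewrite exchange_big -sumrN; apply: eq_bigr => x _.
  by rewrite -sumrN; apply: eq_bigr => y _; rewrite Im_edge_antisym mulrN.
under eq_bigr => x _.
  under eq_bigr => y _ do rewrite mulrBl.
  rewrite big_split /= sumrN; over.
by rewrite big_split /= sumrN swap opprK -/q; lra.
Qed.

Lemma energy_sym : energy (fun x y => (b x y + b y x) / 2) = energy b.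
Proof.
have swap : energy (fun x y => b y x) = energy b.
  rewrite /energy exchange_big; apply: eq_bigr => x _; apply: eq_bigr => y _.
  by rewrite sqnormB_sym.
have -> : energy (fun x y => (b x y + b y x) / 2) =
    (energy b + energy (fun x y => b y x)) / 2.
  rewrite -big_split mulr_suml; apply: eq_bigr => x _.
  by rewrite -big_split mulr_suml; apply: eq_bigr => y _ /=; ring.
by rewrite swap; lra.
Qed.

End DirectedForm.
Arguments directed_form {R V} b T f.

(** * The Laplacian on finitely supported functions *)

Section Laplacian.
Variables (R : realType) (V : countType).

(** The partial sums along the filter of finite sets are constant as soon as
the finite set contains the support. *)
Lemma unconditional_sum_fin (K : numFieldType) (W : normedModType K)
    (T : {fset V}) (F : V -> W) :
  (forall x, x \notin T -> F x = 0) -> summability.sum F = \sum_(x <- T) F x.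
Proof.
move=> FT; rewrite /summability.sum.
apply: (@norm_lim_near_cst _ _ _ _ summability.totally_filter).
exists T => // B /fsubsetP TB /=; rewrite /summability.partial_sum.
rewrite -(big_seq_fsetE _ _ predT F) /=; symmetry.
by apply: big_fset_incl => [|x _ /FT//]; exact/fsubsetP.
Qed.

Lemma l2_dot_fin (m : V -> R) (T : {fset V}) (f g : V -> R[i]) :
  (forall x, x \notin T -> g x = 0) ->
  l2_dot m f g = \sum_(x <- T) (m x)%:C%C * f x * conjc (g x).
Proof.
move=> gT; apply: (@unconditional_sum_fin _ R[i]^o) => x /gT ->.
by rewrite rmorph0 mulr0.
Qed.

Lemma l2_norm_fin (m : V -> R) (T : {fset V}) (f : V -> R[i]) :
  (forall x, x \notin T -> f x = 0) -> l2_norm m f = 1 ->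
  \sum_(x <- T) m x * sqnorm (f x) = 1.
Proof.
move=> fT; rewrite /l2_norm (l2_dot_fin _ _ _ _ fT) Re_sum.
move=> /(congr1 (fun r => r ^+ 2)).
set s := (X in Num.sqrt X); have -> : s = \sum_(x <- T) m x * sqnorm (f x).
  by apply: eq_bigr => x _; case: (f x) => u v; rewrite /sqnorm /=; ring.
move=> s1; have [s0|s0] := leP 0 (\sum_(x <- T) m x * sqnorm (f x)).
  by move: s1; rewrite sqr_sqrtr// expr1n.
by move: s1; rewrite ltr0_sqrtr// expr0n expr1n => /eqP; rewrite eq_sym oner_eq0.
Qed.

Variable G : wdigraph R V.
Implicit Type f : V -> R[i].

Lemma wt_nadj x y : ~~ adj G x y -> wt G x y = 0.
Proof.
by rewrite negb_or => /andP[bxy _]; apply/eqP; rewrite eq_le wt_ge0 andbT leNgt.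
Qed.

Lemma adjC x y : adj G x y = adj G y x.
Proof. by rewrite /adj orbC. Qed.

(** A finite set on which the form of [Delta] at [f] can be computed: it
contains the support of [f] together with all its neighbours. *)
Lemma finite_neighbourhood f : locally_finite G -> finitely_supported f ->
  exists T : {fset V}, (forall x, x \notin T -> f x = 0) /\
    forall x, f x != 0 -> nbhd G x `<=` [set` T].
Proof.
move=> lf ff; pose S := [set x | f x != 0].
have fin : finite_set (S `|` \bigcup_(x in S) nbhd G x).
  by rewrite finite_setU; split=> //; apply: bigcup_finite.
exists (fset_set (S `|` \bigcup_(x in S) nbhd G x)); split=> [x|x fx y xy].
  by rewrite in_fset_set// notin_setE => nx; apply: contrapT => /eqP fx;
    apply: nx; left.
by rewrite /= in_fset_set// mem_set//; right; exists x.
Qed.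

Lemma fsum_nbhd (K : zmodType) (T : {fset V}) (D : set V) (F : V -> K) x :
  nbhd G x `<=` D -> nbhd G x `<=` [set` T] ->
  (forall y, ~~ adj G x y -> F y = 0) ->
  \sum_(y \in D) F y = \sum_(y <- T) F y.
Proof.
move=> xD xT F0; rewrite -(fsbig_widen (nbhd G x) D) => //.
  by apply: fsbig_fwiden => // y [_ /negP]; exact: F0.
by move=> y [_ /negP]; exact: F0.
Qed.

Lemma l2_dot_laplacian (T : {fset V}) f :
  (forall x, x \notin T -> f x = 0) ->
  (forall x, f x != 0 -> nbhd G x `<=` [set` T]) ->
  l2_dot (vm G) (laplacian_fun G f) f = directed_form (wt G) T f.
Proof.
move=> fT nT; rewrite (l2_dot_fin _ _ _ _ fT); apply: eq_bigr => x _.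
have [fx0|fx0] := eqVneq (f x) 0.
  by rewrite fx0 rmorph0 mulr0 big1// => y _; rewrite mulr0.
rewrite -mulr_suml; congr (_ * _).
rewrite /laplacian_fun mulrA -rmorphM mulfV ?gt_eqF ?vm_gt0// rmorph1 mul1r.
by apply: (@fsum_nbhd _ _ _ _ x) => // [|y /wt_nadj ->];
  [exact: nT|rewrite mul0r].
Qed.

Lemma kirchhoff_fin (T : {fset V}) x : kirchhoff G ->
  nbhd G x `<=` [set` T] -> \sum_(y <- T) wt G x y = \sum_(y <- T) wt G y x.
Proof.
move=> /(_ x) K xT; rewrite -(@fsum_nbhd _ T setT _ x)//; last first.
  by move=> y /wt_nadj.
rewrite [LHS]K; apply: (@fsum_nbhd _ _ _ _ x) => // y.
by rewrite adjC => /wt_nadj.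
Qed.

Lemma symmetrized_eq0 x y :
  symmetrized G x y = 0 -> wt G x y - wt G y x = 0.
Proof.
by rewrite /symmetrized; have := wt_ge0 G x y; have := wt_ge0 G y x; lra.
Qed.

Lemma symmetrized_ge0 x y : 0 <= symmetrized G x y.
Proof. by rewrite divr_ge0// addr_ge0// wt_ge0. Qed.

Lemma skew_sum_le (T : {fset V}) (C : R) x :
  nbhd G x `<=` [set` T] ->
  (vm G x)^-1 * \sum_(y \in nbhd G x)
     (`|wt G x y - wt G y x| ^+ 2 / symmetrized G x y) <= C ->
  \sum_(y <- T) (wt G x y - wt G y x) ^+ 2 / symmetrized G x y <= vm G x * C.
Proof.
move=> xT; rewrite ler_pdivrMl ?vm_gt0// => /(le_trans _); apply.
rewrite (@fsum_nbhd _ T _ _ x)//; last first.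
  move=> y nxy; rewrite wt_nadj// wt_nadj 1?adjC//.
  by rewrite subrr normr0 expr0n mul0r.
by apply: ler_sum => y _; rewrite real_normK ?num_real.
Qed.

(** The sectorial estimate; the last sum is [||f||^2] when [T] contains the
support of [f]. *)
Lemma Im_directed_form_le (T : {fset V}) f (C : R) : kirchhoff G ->
  (forall x, f x != 0 -> nbhd G x `<=` [set` T]) ->
  (forall x, (vm G x)^-1 * \sum_(y \in nbhd G x)
     (`|wt G x y - wt G y x| ^+ 2 / symmetrized G x y) <= C) ->
  `|complex.Im (directed_form (wt G) T f)| <=
  2^-1 * (complex.Re (directed_form (wt G) T f)
          + C * (\sum_(x <- T) vm G x * sqnorm (f x)) / 2).
Proof.
move=> K nT hC; rewrite Re_directed_form => [|x _ fx0]; last first.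
  by apply: kirchhoff_fin => //; exact: nT.
rewrite Im_directed_form normrM (ger0_norm (x := 2^-1))// [leLHS]mulrC.
rewrite ler_pM2l ?invr_gt0// -mulrDl -(energy_sym _ _ (wt G)).
apply: le_trans (ler_norm_sum _ _ _) _.
rewrite mulr_sumr -big_split mulr_suml /=; apply: ler_sum => x _.
apply: le_trans (ler_norm_sum _ _ _) _.
apply: (@le_trans _ _ (\sum_(y <- T)
    (symmetrized G x y * sqnorm (f x - f y) +
     (wt G x y - wt G y x) ^+ 2 / symmetrized G x y * sqnorm (f x)) / 2)).
  apply: ler_sum => y _; apply: skew_young; first exact: symmetrized_ge0.
  exact: symmetrized_eq0.
rewrite -mulr_suml big_split /= ler_pM2r ?invr_gt0// lerD2l -mulr_suml.
have [->|fx0] := eqVneq (f x) 0.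
  by rewrite /sqnorm /= expr0n addr0 !mulr0.
rewrite mulrCA mulrA ler_wpM2r ?sqnorm_ge0//.
by apply: skew_sum_le => //; exact: nT.
Qed.

End Laplacian.

Theorem proposition4p2 (R : realType) (V : countType) (G : wdigraph R V)
  (V_infinite : infinite_set [set: V])
  (G_lf : locally_finite G)
  (G_conn : weakly_connected G)
  (G_out : forall x, 0 < outgoing G x)
  (G_kirchhoff : kirchhoff G) :
  (exists C : R, 0 < C /\
     forall x, (vm G x)^-1 *
       \sum_(y \in nbhd G x)
          (`|wt G x y - wt G y x| ^+ 2 / symmetrized G x y) <= C) ->
  sectorial (laplacian G_lf).
Proof.
move=> [C [_ hC]]; exists (- (C / 2)), (atan 2^-1); split.
- by rewrite -(atan0 R) le_atan// invr_ge0.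
- exact: atan_ltpi2.
move=> _ [f [/= ff f1] <-]; rewrite /sector /= atanK.
have [T [fT nT]] := finite_neighbourhood _ _ _ _ G_lf ff.
rewrite (l2_dot_laplacian _ _ _ _ _ fT nT).
have := Im_directed_form_le _ _ _ _ _ _ G_kirchhoff nT hC.
rewrite (l2_norm_fin _ _ _ _ _ fT f1) mulr1 opprK => imle; split=> //.
(* The right-hand side of the estimate is nonnegative, which is the second
   inequality defining the sector. *)
by have := le_trans (normr_ge0 _) imle; lra.
Qed.
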